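(* Let $R$ be a finite Frobenius ring, let $V=R^n$, and let $G$ be a finite permutation group on the coordinates of $V$. Let $H$ be a subgroup of $G$ such that $|H|$ has an inverse in $R$. If $C$ is a left $G$-code of length $n$ over $R$, then $$W^{H}_{(C^{\perp})\theta_H}(x,y) = \frac{1}{|C\theta_H|}\, W^{H}_{C\theta_H}\bigl(x+(|R|-1)y,\; x-y\bigr).$$
   Context: A finite (associative, unital) ring $R$ is Frobenius if $R/\mathrm{Rad}(R)\cong \mathrm{Soc}(R_R)$ as right $R$-modules and $R/\mathrm{Rad}(R)\cong\mathrm{Soc}({}_RR)$ as left $R$-modules. $R$ need not be commutative. On $V=R^n$ put $(u,v):=u_1v_1+\cdots+u_nv_n$. A permutation group $G$ on $\{1,\dots,n\}$ acts on $V$ on the right by $(vg)_i = v_{ig^{-1}}$. A left $G$-code is a left $R$-submodule $C$ of $V$ with $Cg\subseteq C$ for all $g\in G$; its right dual is $C^{\perp}:=\{u\in V:(v,u)=0\text{ for all }v\in C\}$. ''$|H|$ has an inverse in $R$'' means $|H|\cdot 1_R$ is a unit. Define $v\theta_H:=\frac1{|H|}\sum_{h\in H}vh$ for $v\in V$ and $X\theta_H:=\{v\theta_H:v\in X\}$ for $X\subseteq V$. Let $H_V(\alpha_1),\dots,H_V(\alpha_t)$ be the orbits of $H$ on the coordinate set $\{1,\dots,n\}$, and let $\overline{H_V(\alpha_i)}\in V$ be the vector with entry $1$ at the positions in $H_V(\alpha_i)$ and $0$ elsewhere. Every $u\in V\theta_H$ is uniquely $u=\sum_{i=1}^t u_i\overline{H_V(\alpha_i)}$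 with $u_i\in R$; its $H$-weight is $\mathrm{wt}_H(u):=|\{i:u_i\ne0\}|$. For a left or right $R$-submodule $D\subseteq V\theta_H$, the $H$-weight enumerator is $W_D^H(x,y):=\sum_{u\in D}x^{t-\mathrm{wt}_H(u)}y^{\mathrm{wt}_H(u)}$. *)

(* Defs.v *)
From HB Require Import structures.
From mathcomp Require Import all_boot all_order all_algebra all_fingroup.
From mathcomp Require Import mpoly.

Set Implicit Arguments.
Unset Strict Implicit.
Unset Printing Implicit Defensive.

Import GRing.Theory.
Local Open Scope ring_scope.

Section FrobeniusRing.
Variable R : finNzRingType.
Implicit Types I S : {set R}.

Definition additive_set I : bool :=
  (0 \in I) && [forall x in I, forall y in I, x - y \in I].

Definition left_ideal I : bool :=
  additive_set I && [forall r : R, forall x in I, r * x \in I].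

Definition right_ideal I : bool :=
  additive_set I && [forall r : R, forall x in I, x * r \in I].

Definition maximal_left_ideal I : bool :=
  maxset (fun J : {set R} => left_ideal J && (J != [set: R])) I.

(* Jacobson radical. It is a two-sided ideal and also equals the intersection
   of the maximal right ideals. *)
Definition Rad : {set R} := \bigcap_(I | maximal_left_ideal I) I.

Definition minimal_left_ideal I : bool :=
  minset (fun J : {set R} => left_ideal J && (J != [set 0])) I.

Definition minimal_right_ideal I : bool :=
  minset (fun J : {set R} => right_ideal J && (J != [set 0])) I.

Definition sum_of_sets (P : pred {set R}) : {set R} :=
  [set \sum_(I : {set R} | P I) f I
     | f : {ffun {set R} -> R} & [forall (I : {set R} | P I), f I \in I]].

(* Socle of R as a left, resp. right, module: the sum of the simple left,
   resp. right, submodules. *)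
Definition left_Soc : {set R} := sum_of_sets minimal_left_ideal.
Definition right_Soc : {set R} := sum_of_sets minimal_right_ideal.

Definition add_coset I (x : R) : {set R} := [set x + a | a in I].
Definition add_cosets I : {set {set R}} := [set add_coset I x | x : R].

(* The elements of R / I are the cosets x + I, and only the values of [phi] on
   cosets matter: it is a bijection R / I -> S which is additive and R-linear,
   where (x + I) + (y + I) = (x + y) + I and r (x + I) = r x + I, resp.
   (x + I) r = x r + I. *)
Definition left_quotient_iso I S : Prop :=
  exists phi : {set R} -> R,
    [/\ {in add_cosets I &, injective phi},
        phi @: add_cosets I = S,
        forall x y, phi (add_coset I (x + y)) =
                    phi (add_coset I x) + phi (add_coset I y)
      & forall r x, phi (add_coset I (r * x)) = r * phi (add_coset I x)].

Definition right_quotient_iso I S : Prop :=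
  exists phi : {set R} -> R,
    [/\ {in add_cosets I &, injective phi},
        phi @: add_cosets I = S,
        forall x y, phi (add_coset I (x + y)) =
                    phi (add_coset I x) + phi (add_coset I y)
      & forall r x, phi (add_coset I (x * r)) = phi (add_coset I x) * r].

Definition Frobenius_ring : Prop :=
  right_quotient_iso Rad right_Soc /\ left_quotient_iso Rad left_Soc.

End FrobeniusRing.

Arguments Frobenius_ring R : clear implicits.

Section Codes.
Variables (R : finUnitRingType) (n : nat).
Implicit Types (u v : 'rV[R]_n) (C D X : {set 'rV[R]_n}).
Implicit Types (G H : {group 'S_n}) (O : {set 'I_n}).

Definition coord_form u v : R := \sum_(i < n) u 0 i * v 0 i.

Definition coord_act v (g : 'S_n) : 'rV[R]_n := \row_i v 0 ((g^-1)%g i).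

Definition left_G_code G C : Prop :=
  submod_closed C /\
  forall g v, g \in G -> v \in C -> coord_act v g \in C.

Definition right_dual C : {set 'rV[R]_n} :=
  [set u | [forall v in C, coord_form v u == 0]].

Definition theta H v : 'rV[R]_n :=
  (#|H|%:R)^-1 *: \sum_(h in H) coord_act v h.

Definition theta_set H X : {set 'rV[R]_n} := [set theta H v | v in X].

Definition coord_orbits H : {set {set 'I_n}} := [set orbit 'P H i | i : 'I_n].

Definition orbit_vec O : 'rV[R]_n := \row_i (i \in O)%:R.

(* Coefficient of [orbit_vec O] in [u], namely the entry of u at some position
   of O. It is meaningful only for u in V theta_H, where it is the coefficient
   in the unique decomposition of u; see [orbit_coef_decomp] and
   [orbit_coef_uniq]. *)
Definition orbit_coef O u : R :=
  if [pick i in O] is Some i then u 0 i else 0.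

Definition wtH H u : nat :=
  #|[set O in coord_orbits H | orbit_coef O u != 0]|.

(* 'X_0 and 'X_1 are the variables x and y. *)
Definition weight_enum H D : {mpoly rat[2]} :=
  \sum_(u in D) 'X_(0 : 'I_2) ^+ (#|coord_orbits H| - wtH H u)
              * 'X_(1 : 'I_2) ^+ wtH H u.

Lemma coord_actM v g h : coord_act v (g * h) = coord_act (coord_act v g) h.
Proof. by apply/rowP=> i; rewrite !mxE invMg permM. Qed.

Lemma coord_act_theta H v h : h \in H -> coord_act (theta H v) h = theta H v.
Proof.
move=> hH; apply/rowP=> i; rewrite !mxE; congr (_ * _); rewrite !summxE.
rewrite [RHS](reindex_inj (mulIg h)) /=.
apply: eq_big => [g|g _]; first by rewrite groupMr.
by rewrite coord_actM [RHS]mxE.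
Qed.

Lemma theta_orbit H v i j :
  i \in orbit 'P H j -> theta H v 0 i = theta H v 0 j.
Proof.
case/orbitP=> h hH <-; rewrite /= /aperm -[in LHS](coord_act_theta v hH) mxE.
by rewrite permK.
Qed.

Lemma orbit_sum_coord H (c : {set 'I_n} -> R) i :
  (\sum_(O in coord_orbits H) c O *: orbit_vec O) 0 i = c (orbit 'P H i).
Proof.
have iO : orbit 'P H i \in coord_orbits H by apply: imset_f.
rewrite summxE (bigD1 _ iO) /= !mxE orbit_refl mulr1 big1 ?addr0 // => O.
case/andP=> /imsetP[j _ ->] neq; rewrite !mxE.
case: (boolP (i \in orbit 'P H j)) => [ij|_]; last by rewrite mulr0.
by case/eqP: neq; apply/esym/orbit_in_eqP; rewrite ?subsetT.
Qed.

Lemma orbit_coef_decomp H u : u \in theta_set H [set: 'rV[R]_n] ->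
  u = \sum_(O in coord_orbits H) orbit_coef O u *: orbit_vec O.
Proof.
case/imsetP=> v _ ->; apply/rowP=> i; rewrite orbit_sum_coord /orbit_coef.
case: pickP => [j ji|/(_ i)]; last by rewrite orbit_refl.
by rewrite (theta_orbit _ ji).
Qed.

Lemma orbit_coef_uniq H u (c : {set 'I_n} -> R) :
  u = \sum_(O in coord_orbits H) c O *: orbit_vec O ->
  forall O, O \in coord_orbits H -> c O = orbit_coef O u.
Proof.
move=> -> O /imsetP[i _ ->]; rewrite /orbit_coef.
case: pickP => [j ji|/(_ i)]; last by rewrite orbit_refl.
rewrite orbit_sum_coord; congr (c _).
by apply/esym/orbit_in_eqP; rewrite ?subsetT.
Qed.

End Codes.

(* Main.v *)
Require Import Defs.
From HB Require Import structures.
From mathcomp Require Import all_boot all_order all_algebra all_fingroup.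
From mathcomp Require Import mpoly.
From mathcomp Require Import zify.

Set Implicit Arguments.
Unset Strict Implicit.
Unset Printing Implicit Defensive.

Import GRing.Theory.
Local Open Scope ring_scope.

(* No characters are used. Write W for V theta_H, equipped with the coordinate
   form, on which theta_H is self-adjoint; hence (C^perp) theta_H is the dual in
   W of D = C theta_H, because C theta_H is contained in C.

   The dual in W of a left submodule D has |W| / |D| elements. Refining
   0 <= D <= W to a chain with simple quotients, it suffices that the index of
   duals drops by at most |T| across a step with quotient T = R / M. That index
   is at most |Hom(T, R)|, and a map from T to R lands in the left socle, which
   is isomorphic to R / Rad R, so only |Hom(T, R / Rad R)| <= |T| is needed.
   As the two bounds from 0 to D and from D to W multiply to an equality, both
   are equalities.

   For a set S of orbits let W_S be the vectors of W supported in S. Orbit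
   lengths divide |H|, hence are units, so the dual of W_(~S) is W_S; the
   cardinality formula for D + W_(~S) then reads
   |D| |D' :&: W_S| = |R| ^ |S| |D :&: W_(~S)|.
   Since the sum over S of |D :&: W_S| x ^ (t - |S|) y ^ |S| is the weight
   enumerator of D at (x + y, y), summing over S gives the identity. *)

(** * Counting along additive maps *)

(** Each fibre of (a, b) |-> f a + b on A * B is a translate of the set of pairs (k, - f k) with k
    in A and f k in B. For B = 0 this reads |A| = |ker| |im|; for f the identity, |A| |B| = |A :&:
    B| |A + B|. *)
Lemma card_preim_add (U V : finZmodType) (f : U -> V)
    (A : {set U}) (B : {set V}) :
  {morph f : x y / x - y} -> zmod_closed A -> zmod_closed B ->
  (#|A| * #|B| =
   #|[set a in A | f a \in B]| * #|[set (f p.1 + p.2)%R | p in setX A B]|)%N.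
Proof.
move=> fB Azm Bzm.
have f0 : f 0 = 0 by rewrite -[in LHS](subrr 0) fB subrr.
have fN x : f (- x) = - f x by rewrite -(sub0r x) fB f0 sub0r.
have fD x y : f (x + y) = f x + f y by rewrite -[in LHS](opprK y) fB fN opprK.
have [A0 AB] := Azm; have [B0 BB] := Bzm.
have [_ AD] := GRing.zmod_closedD Azm; have [_ BD] := GRing.zmod_closedD Bzm.
rewrite -cardsX -sum1_card.
rewrite (partition_big_imset (fun p : U * V => f p.1 + p.2)) /=.
rewrite mulnC -sum_nat_const; apply: eq_bigr => _ /imsetP[[a0 b0] /setXP[a0A b0B] ->] /=.
rewrite sum1dep_card.
rewrite -(card_imset (f := fun k => (a0 + k, b0 - f k))); last first.
  by move=> k l [/addrI].
apply: eq_card => -[a b]; rewrite inE /= in_setX.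
apply/idP/imsetP => [/andP[/andP[aA bB] /eqP eq]|[k]].
  have fk : f (a - a0) = b0 - b.
    by rewrite fB; apply/eqP; rewrite subr_eq addrC addrA -eq addrK.
  exists (a - a0); first by rewrite inE AB //= fk BB.
  by rewrite fk addrC subrK opprB addrC subrK.
rewrite inE => /andP[kA fkB] [-> ->].
by rewrite AD // BB //= fD -addrA [f k + _]addrC subrK.
Qed.

(** * Simple modules over a finite Frobenius ring *)

Section LeftIdeals.
Variable R : finNzRingType.
Implicit Types (I M : {set R}) (r s x y : R).

Lemma left_idealP I :
  reflect (zmod_closed I /\ forall r x, x \in I -> r * x \in I) (left_ideal I).
Proof.
apply: (iffP idP) => [/andP[/andP[I0 /forall_inP IB] /forallP IM]|[[I0 IB] IM]].
  split=> [|r x xI]; last by have /forall_inP := IM r; apply.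
  by split=> // x y xI yI; have /forall_inP := IB x xI; apply.
apply/andP; split; last by apply/forallP=> r; apply/forall_inP=> x; apply: IM.
by rewrite /additive_set I0; apply/forall_inP=> x xI; apply/forall_inP=> y; apply: IB.
Qed.

Lemma left_ideal_eqT I : left_ideal I -> (I == [set: R]) = (1 \in I).
Proof.
case/left_idealP=> _ IM; apply/eqP/idP => [->|I1]; first by rewrite inE.
by apply/setP=> x; rewrite inE -[x]mulr1 IM.
Qed.

(** M + R k is a left ideal strictly above M, so maximality puts 1 in it. The resulting left inverse
    of k modulo M is the form in which simplicity of R / M is used below. *)
Lemma maximal_left_idealP M :
  reflect [/\ left_ideal M, 1 \notin M
            & forall k, k \notin M -> exists s, 1 - s * k \in M]
          (maximal_left_ideal M).
Proof.
apply: (iffP maxsetP) => [[/andP[Mid]]|[Mid M1 Mmax]].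
  rewrite left_ideal_eqT // => M1 Mmax; split=> // k kM.
  have /left_idealP[Mzm MM] := Mid; have [M0 MB] := Mzm.
  have [_ MD] := GRing.zmod_closedD Mzm.
  pose N := [set p.1 + p.2 * k | p in setX M [set: R]].
  have Nid : left_ideal N.
    apply/left_idealP; split; first split.
    - by apply/imsetP; exists (0, 0); rewrite ?inE ?M0 //= mul0r addr0.
    - move=> _ _ /imsetP[[a r] /setXP[aM _] ->] /imsetP[[b s] /setXP[bM _] ->].
      apply/imsetP; exists (a - b, r - s); first by rewrite !inE MB.
      by rewrite /= mulrBl opprD addrACA.
    - move=> t _ /imsetP[[a r] /setXP[aM _] ->].
      apply/imsetP; exists (t * a, t * r); first by rewrite !inE MM.
      by rewrite /= mulrDr mulrA.
  have MN : M \subset N.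
    apply/subsetP=> a aM; apply/imsetP; exists (a, 0); first by rewrite !inE aM.
    by rewrite /= mul0r addr0.
  have kN : k \in N.
    by apply/imsetP; exists (0, 1); rewrite ?inE ?M0 //= mul1r add0r.
  have : 1 \in N.
    apply: contraNT kM => N1; rewrite -(Mmax N) //.
    by rewrite Nid left_ideal_eqT.
  case/imsetP=> -[a s] /setXP[aM _] /= eq1.
  by exists s; rewrite eq1 addrK.
split=> [|I /andP[Iid I1] MI]; first by rewrite Mid left_ideal_eqT.
apply/eqP; rewrite eqEsubset MI andbT; apply/subsetP=> k kI.
rewrite left_ideal_eqT // in I1.
apply: contraR I1 => /Mmax[s sM].
have /left_idealP[Izm IM] := Iid; have [_ ID] := GRing.zmod_closedD Izm.
by rewrite -(subrK (s * k) 1) ID ?IM // (subsetP MI).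
Qed.

(** This set is the annihilator of the nonzero class of y, which generates the simple module R / M;
    the quotient of R by it is again R / M. *)
Lemma maximal_left_ideal_colon M y :
  maximal_left_ideal M -> y \notin M ->
  maximal_left_ideal [set r | r * y \in M].
Proof.
case/maximal_left_idealP=> /left_idealP[[M0 MB] MM] M1 Mmax yM.
apply/maximal_left_idealP; split; last first.
(* If 1 - s k y lies in M, so does y (1 - s k y) = (1 - y s k) y. *)
- move=> k; rewrite inE => /Mmax[s sM]; exists (y * s).
  by rewrite inE mulrBl mul1r -!mulrA -[X in X - _]mulr1 -mulrBr MM.
- by rewrite inE mul1r.
apply/left_idealP; split; first split.
- by rewrite inE mul0r.
- by move=> a b; rewrite !inE mulrBl; apply: MB.
- by move=> r x; rewrite !inE -mulrA; apply: MM.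
Qed.

(** The radical annihilates simple modules: the annihilator of a nonzero class y of R / M is a
    maximal left ideal, hence contains x. *)
Lemma RadMr M x y : maximal_left_ideal M -> x \in Rad R -> x * y \in M.
Proof.
move=> Mmax /bigcapP xJ; have [yM|/(maximal_left_ideal_colon Mmax)] := boolP (y \in M).
  by case/maximal_left_idealP: Mmax => /left_idealP[_ MM] _ _; apply: MM.
by move/xJ; rewrite inE.
Qed.

Lemma left_ideal_Rad : left_ideal (Rad R).
Proof.
have idM M : maximal_left_ideal M -> left_ideal M by case/maximal_left_idealP.
apply/left_idealP; split; first split.
- by apply/bigcapP=> M /idM/left_idealP[[]].
- move=> x y /bigcapP xJ /bigcapP yJ; apply/bigcapP=> M Mmax.
  by have /left_idealP[[_ MB] _] := idM M Mmax; apply: MB; [apply: xJ | apply: yJ].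
- move=> r x /bigcapP xJ; apply/bigcapP=> M Mmax.
  by have /left_idealP[_ MM] := idM M Mmax; apply/MM/xJ.
Qed.

(* With [T = R / M], the sets [X / Rad R] and [D / M] are [Hom(T, R / Rad R)]
   and [End T], so the claim reads [|Hom(T, R / Rad R)| <= |T|]. It follows
   from counting in two ways the pairs (x, y) in X * R with x * y in M, i.e.
   the zeros of the composition pairing Hom(T, R / Rad R) * T -> End T. *)
Lemma card_hom_simple_semisimple M :
  maximal_left_ideal M ->
  (#|[set x | [forall m in M, (m * x)%R \in Rad R]]| * #|M| <= #|Rad R| * #|R|)%N.
Proof.
move=> Mmax; set J := Rad R; set X := [set x | _].
have /maximal_left_idealP[/left_idealP[Mzm MM] M1 Mk] := Mmax.
have [M0 MB] := Mzm; have [_ MD] := GRing.zmod_closedD Mzm.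
have /left_idealP[Jzm JM] := left_ideal_Rad; have [J0 JB] := Jzm.
pose D := [set d | [forall m in M, m * d \in M]].
have XP x : reflect (forall m, m \in M -> m * x \in J) (x \in X).
  by rewrite inE; apply: forall_inP.
have DP d : reflect (forall m, m \in M -> m * d \in M) (d \in D).
  by rewrite inE; apply: forall_inP.
have Xzm : zmod_closed X.
  split; first by apply/XP=> m _; rewrite mulr0.
  by move=> x y /XP xX /XP yX; apply/XP=> m mM; rewrite mulrBr JB ?xX ?yX.
have Dzm : zmod_closed D.
  split; first by apply/DP=> m _; rewrite mulr0.
  by move=> x y /DP xX /DP yX; apply/DP=> m mM; rewrite mulrBr MB ?xX ?yX.
have JX : J \subset X by apply/subsetP=> x xJ; apply/XP=> m _; apply: JM.
have MsubD : M \subset D by apply/subsetP=> x xM; apply/DP=> m _; apply: MM.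
have ltMD : (#|M| < #|D|)%N.
  apply: proper_card; apply/properP; split=> //; exists 1 => //.
  by apply/DP=> m; rewrite mulr1.
pose K x := [set y | x * y \in M].
pose L y := [set x in X | x * y \in M].
have count : (\sum_(x in X) #|K x| = \sum_y #|L y|)%N.
  under eq_bigr do rewrite -sum1dep_card.
  rewrite (exchange_big_dep predT) //=.
  by apply: eq_bigr => y _; rewrite sum1dep_card; apply: eq_card => x; rewrite !inE.
(* Here X y + M is contained in D: for m' in M and x in X, m' x is in [Rad R], so m' x y is in M. *)
have Lge y : (#|X| * #|M| <= #|L y| * #|D|)%N.
  rewrite (@card_preim_add _ _ (fun x => x * y)) //; last by move=> ? ?; rewrite mulrBl.
  rewrite leq_mul2l; apply/orP; right; apply/subset_leq_card/subsetP.
  move=> _ /imsetP[[x m] /setXP[/XP xX mM] ->]; apply/DP=> m' m'M /=.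
  by rewrite mulrDr MD ?(MM _ m) // mulrA; apply: RadMr; rewrite ?xX.
have LM y : y \in M -> #|L y| = #|X|.
  move=> yM; apply: eq_card => x; rewrite inE; case: (x \in X) => //=.
  by rewrite MM.
(* Schur's lemma: for s with x s outside M, an e in D with x s e in M must lie in M, as nonzero
   endomorphisms of R / M are injective. *)
have Kle x : x \in X -> x \notin J -> (#|D| * #|K x| <= #|M| * #|R|)%N.
  move=> /XP xX xJ.
  (* Pick M' maximal missing x, and s with 1 - s x in M'. If x s were in M, then x s x would be in
     [Rad R], and x = x (1 - s x) + x s x in M'. *)
  have [s xsM] : exists s, x * s \notin M.
    have /existsP[M' /andP[M'max xM']] : [exists M', maximal_left_ideal M' && (x \notin M')].
      apply: contraR xJ => /existsPn nM'; apply/bigcapP=> M' M'max.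
      by have := nM' M'; rewrite M'max negbK.
    have /maximal_left_idealP[/left_idealP[[_ M'B] M'M] _ M'k] := M'max.
    have [s sxM'] := M'k x xM'; exists s; apply/negP=> xsM.
    have := xX _ xsM => /bigcapP/(_ M' M'max) xsx.
    case/negP: xM'; rewrite -(subrK (x * (s * x)) x).
    have [_ M'D] : addr_closed M'.
      by apply/GRing.zmod_closedD; split=> //; have /maximal_left_idealP[/left_idealP[[]]] := M'max.
    by rewrite M'D 1?mulrA // -mulrA -[X in X - _]mulr1 -mulrBr M'M.
  rewrite (@card_preim_add _ _ (fun e => s * e)) //; first last.
  - by split=> [|y z]; rewrite !inE ?mulr0 // mulrBr; apply: MB.
  - by move=> ? ?; rewrite mulrBr.
  apply: leq_mul; last exact: max_card.
  apply/subset_leq_card/subsetP=> e; rewrite !inE => /andP[/forall_inP eD].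
  apply: contraLR => eM; rewrite mulrA.
  apply/negP=> xse.
  have [t tM] := Mk _ xsM.
  have : (1 - t * (x * s)) * e \in M by apply: eD.
  rewrite mulrBl mul1r => eq.
  by case/negP: eM; rewrite -(subrK (t * (x * s) * e) e) MD // -mulrA MM.
have NX : (#|D| * \sum_(x in X) #|K x| <=
           #|D| * (#|J| * #|R|) + (#|X| - #|J|) * (#|M| * #|R|))%N.
  rewrite (big_setID J) /= (setIidPr JX) mulnDr leq_add //.
    rewrite leq_mul2l -sum_nat_const; apply/orP; right.
    by apply: leq_sum => x _; apply: max_card.
  rewrite big_distrr /= -{2}(setIidPr JX) -cardsD -sum_nat_const.
  by apply: leq_sum => x /setDP[xX xJ]; apply: Kle.
have NY : (#|M| * (#|D| * #|X|) + (#|R| - #|M|) * (#|X| * #|M|) <=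
           #|D| * \sum_y #|L y|)%N.
  rewrite (bigID (mem M)) /= mulnDr leq_add //.
    rewrite mulnCA leq_mul2l -sum_nat_const; apply/orP; right.
    by apply: leq_sum => y yM; rewrite LM.
  have -> : (#|R| - #|M| = #|~: M|)%N by rewrite -[#|R|](cardsC M) addKn.
  rewrite big_distrr /= -sum_nat_const.
  under [X in (_ <= X)%N]eq_bigl do rewrite -in_setC.
  by apply: leq_sum => y _; rewrite [leqRHS]mulnC.
have XR := subset_leq_card JX; have MR := max_card M.
move: NX NY; rewrite count => NX NY; have := leq_trans NY NX; move: ltMD XR MR.
move: #|D| #|M| #|X| #|J| #|R| => d m xx j r; clear.
(* The two bounds combine to (d - m) m xx <= (d - m) j r, and d > m because 1 lies in D but not in
   M. *)
move=> lt le1 le2 le; rewrite -(leq_pmul2l (m := d - m)%N) ?subn_gt0 //.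
move: le; rewrite -(subnKC (ltnW lt)) -(subnKC le1) -(subnKC le2) !addKn.
move: (d - m)%N (xx - j)%N (r - m)%N => a b c; nia.
Qed.

(** A nonzero r killed by M spans a copy R r of R / M, which is a minimal left ideal. *)
Lemma annihilator_subset_left_Soc M :
  maximal_left_ideal M -> [set r | [forall m in M, m * r == 0]] \subset left_Soc R.
Proof.
case/maximal_left_idealP=> _ _ Mk; apply/subsetP=> r; rewrite inE => /forall_inP rM.
have {}rM m : m \in M -> m * r = 0 by move/rM/eqP.
have Soc0 : 0 \in left_Soc R.
  apply/imsetP; exists [ffun=> 0]; last by rewrite big1 // => I _; rewrite ffunE.
  rewrite inE; apply/forall_inP=> I /minsetP[/andP[/left_idealP[[I0 _] _] _] _].
  by rewrite ffunE.
have [->//|r0] := eqVneq r 0.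
pose Rr := [set s * r | s : R].
have rRr : r \in Rr by apply/imsetP; exists 1; rewrite ?mul1r.
have Rrid : left_ideal Rr.
  apply/left_idealP; split; first split.
  - by apply/imsetP; exists 0; rewrite ?mul0r.
  - move=> _ _ /imsetP[s _ ->] /imsetP[t _ ->].
    by apply/imsetP; exists (s - t); rewrite ?mulrBl.
  - by move=> t _ /imsetP[s _ ->]; apply/imsetP; exists (t * s); rewrite ?mulrA.
have Rrmin : minimal_left_ideal Rr.
  apply/minsetP; split=> [|I /andP[Iid I0] IRr].
    rewrite Rrid; apply: contra r0 => /eqP eq.
    by move: rRr; rewrite eq inE.
  have /left_idealP[[I00 _] IM] := Iid.
  have [z zI z0] : exists2 z, z \in I & z != 0.
    apply/exists_inP; apply: contraR I0 => /exists_inPn nz.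
    by apply/eqP/setP=> z; rewrite inE; apply/idP/eqP => [/nz/negPn/eqP//|->].
  have /imsetP[s _ zE] := subsetP IRr z zI.
  (* With t s = 1 modulo M, r = t s r = t z is back in I. *)
  have sM : s \notin M by apply: contra z0 => /rM; rewrite zE => ->.
  have [t /rM] := Mk s sM; rewrite mulrBl mul1r -mulrA -zE => /eqP.
  rewrite subr_eq0 => /eqP rE.
  apply/eqP; rewrite eqEsubset IRr /=; apply/subsetP=> _ /imsetP[a _ ->].
  by rewrite rE !IM.
apply/imsetP; exists [ffun I => if I == Rr then r else 0].
  rewrite inE; apply/forall_inP=> I /minsetP[/andP[/left_idealP[[I0 _] _] _] _].
  by rewrite ffunE; case: eqP => [->|].
rewrite (bigD1 Rr) //= ffunE eqxx big1 ?addr0 // => I /andP[_ /negbTE neq].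
by rewrite ffunE neq.
Qed.

Lemma add_coset_eq I x y :
  zmod_closed I -> (add_coset I x == add_coset I y) = (x - y \in I).
Proof.
case=> I0 IB; have [_ ID] : addr_closed I by apply: GRing.zmod_closedD.
apply/eqP/idP => [eq|xyI].
  have : x \in add_coset I y by rewrite -eq; apply/imsetP; exists 0; rewrite ?addr0.
  by case/imsetP=> a aI ->; rewrite addrC addKr.
apply/setP=> z; apply/imsetP/imsetP => -[a aI ->].
  by exists (x - y + a); [apply: ID | rewrite addrA [y + _]addrC subrK].
by exists (a - (x - y)); [apply: IB | rewrite opprB [a + _]addrC addrA [x + _]addrC subrK].
Qed.

(* [Hom(R / M, R)] is the right annihilator of M, and it takes values in the
   left socle, which is a copy of [R / Rad R]. *)
Lemma Frobenius_card_annihilator M :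
  Frobenius_ring R -> maximal_left_ideal M ->
  (#|[set r | [forall m in M, (m * r)%R == 0%R]]| * #|M| <= #|R|)%N.
Proof.
case=> _ [phi [phi_inj phi_im phiD phiM]] Mmax.
set A := [set r | _]; have /left_idealP[Jzm JM] := left_ideal_Rad.
have [J0 _] := Jzm.
(* g is left R-linear from R to R, with kernel [Rad R] and image the left socle. *)
pose g x := phi (add_coset (Rad R) x).
have g0 : g 0 = 0 by rewrite -[LHS](addrK (g 0)) -phiD addr0 subrr.
have gB : {morph g : x y / x - y}.
  by move=> x y; rewrite /g -mulN1r phiD phiM mulN1r.
have gK x : g x = 0 -> x \in Rad R.
  move=> gx; have /phi_inj : phi (add_coset (Rad R) x) = phi (add_coset (Rad R) 0).
    by rewrite -/(g _) -/(g _) gx g0.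
  by move=> /(_ (imset_f _ isT) (imset_f _ isT))/eqP; rewrite add_coset_eq // subr0; apply.
pose X := [set x | [forall m in M, m * x \in Rad R]].
have XP x : reflect (forall m, m \in M -> m * x \in Rad R) (x \in X).
  by rewrite inE; apply: forall_inP.
have Xzm : zmod_closed X.
  split; first by apply/XP=> m _; rewrite mulr0.
  move=> x y /XP xX /XP yX; apply/XP=> m mM; rewrite mulrBr.
  by apply: Jzm.2; [apply: xX | apply: yX].
(* On X the map g has kernel [Rad R], and g X contains A: if r = g x is in A, then g (m x) = m r = 0
   for m in M, so x is in X. *)
have AX : (#|Rad R| * #|A| <= #|X|)%N.
  rewrite -[#|X|]muln1 -(cards1 (0 : R)) (@card_preim_add _ _ g X) //; last first.
    by split=> [|x y]; rewrite !inE // => /eqP-> /eqP->; rewrite subrr.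
  apply: leq_mul; apply/subset_leq_card/subsetP.
    move=> x xJ; rewrite inE; apply/andP; split; first by apply/XP=> m _; apply: JM.
    apply/set1P; rewrite -g0; congr phi; apply/eqP.
    by rewrite add_coset_eq // subr0.
  move=> r rA; have := subsetP (annihilator_subset_left_Soc Mmax) r rA.
  rewrite -phi_im => /imsetP[_ /imsetP[x _ ->]] rE.
  apply/imsetP; exists (x, 0); last by rewrite addr0.
  rewrite !inE eqxx andbT; apply/forall_inP=> m mM; apply: gK.
  rewrite /g phiM -rE; apply/eqP.
  by move: rA; rewrite inE => /forall_inP; apply.
have J_gt0 : (0 < #|Rad R|)%N by apply/card_gt0P; exists 0.
rewrite -(leq_pmul2l J_gt0) mulnA.
by apply: leq_trans (card_hom_simple_semisimple Mmax); rewrite leq_mul2r AX orbT.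
Qed.

End LeftIdeals.

(** * Cardinality of dual modules *)

Section Duality.
Variables (R : finUnitRingType) (n : nat).
Implicit Types (u v b : 'rV[R]_n) (A D W : {set 'rV[R]_n}).

Lemma coord_formZl r u v : coord_form (r *: u) v = r * coord_form u v.
Proof. by rewrite mulr_sumr; apply: eq_bigr => i _; rewrite mxE mulrA. Qed.

Lemma coord_formDl u u' v :
  coord_form (u + u') v = coord_form u v + coord_form u' v.
Proof. by rewrite -big_split; apply: eq_bigr => i _; rewrite mxE mulrDl. Qed.

Lemma coord_formBr u v v' :
  coord_form u (v - v') = coord_form u v - coord_form u v'.
Proof. by rewrite -sumrB; apply: eq_bigr => i _; rewrite !mxE mulrBr. Qed.

Lemma right_dualP D u :
  reflect (forall v, v \in D -> coord_form v u = 0) (u \in right_dual D).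
Proof. by rewrite inE; apply: (iffP forall_inP) => uD v vD; apply/eqP/uD. Qed.

Lemma right_dual_zmod D : zmod_closed (right_dual D).
Proof.
split=> [|u v /right_dualP uD /right_dualP vD]; apply/right_dualP => w wD.
  by apply: big1 => i _; rewrite mxE mulr0.
by rewrite coord_formBr uD ?vD // subrr.
Qed.

Definition add_line A b : {set 'rV[R]_n} :=
  [set p.1 *: b + p.2 | p in setX [set: R] A].

Lemma add_lineP A b v :
  reflect (exists r, v - r *: b \in A) (v \in add_line A b).
Proof.
apply: (iffP imsetP) => [[[r a] /setXP[_ aA] ->]|[r vA]]; exists r || exists (r, v - r *: b).
- by rewrite addrC addKr.
- by rewrite !inE.
- by rewrite addrC subrK.
Qed.

Lemma add_line_submod A b : submod_closed A -> submod_closed (add_line A b).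
Proof.
case=> A0 Alin; split; first by apply/add_lineP; exists 0; rewrite scale0r subr0.
move=> r u v /add_lineP[s uA] /add_lineP[t vA]; apply/add_lineP; exists (r * s + t).
by rewrite scalerDl opprD addrACA -scalerA -scalerBr; apply: Alin.
Qed.

Lemma add_line_sub A D b :
  submod_closed D -> A \subset D -> b \in D -> add_line A b \subset D.
Proof.
case=> _ Dlin AD bD; apply/subsetP=> _ /imsetP[[r a] /setXP[_ aA] ->].
exact/Dlin/(subsetP AD).
Qed.

Lemma sub_add_line A b : A \subset add_line A b.
Proof. by apply/subsetP=> a aA; apply/add_lineP; exists 0; rewrite scale0r subr0. Qed.

Lemma mem_add_line A b : submod_closed A -> b \in add_line A b.
Proof. by case=> A0 _; apply/add_lineP; exists 1; rewrite scale1r subrr. Qed.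

(* Here [add_line A b / A] is simple, isomorphic to [R / M], and evaluation at
   [b] embeds the quotient of the two duals into [Hom(R / M, R)]. *)
Lemma card_dual_add_line W A b :
  Frobenius_ring R -> zmod_closed W -> submod_closed A ->
  maximal_left_ideal [set r : R | r *: b \in A] ->
  (#|W :&: right_dual A| * #|A| <=
   #|W :&: right_dual (add_line A b)| * #|add_line A b|)%N.
Proof.
move=> frobR Wzm Asub Mmax; set M := [set r | _] in Mmax.
have Azm := GRing.submod_closedB Asub.
have Tzm : zmod_closed [set: R] by split=> [|x y _ _]; rewrite inE.
have cardB : (#|R| * #|A| = #|M| * #|add_line A b|)%N.
  rewrite -cardsT (@card_preim_add _ _ (fun r => r *: b)) //; last first.
    by move=> r s; rewrite scalerBl.
  by congr (_ * _)%N; apply: eq_card => r; rewrite !inE.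
have zm1 : zmod_closed [set 0 : R].
  by split=> [|x y]; rewrite !inE // => /eqP-> /eqP->; rewrite subrr.
have Wdzm : zmod_closed (W :&: right_dual A).
  have [[W0 WB] [d0 dB]] := (Wzm, right_dual_zmod A).
  split=> [|u v /setIP[uW ud] /setIP[vW vd]]; apply/setIP; split=> //.
    exact: WB.
  exact: dB.
(* Evaluation at b has kernel [B'] and image [I]; M kills [I] because m b lies in A for m in M. *)
have := card_preim_add (coord_formBr b) Wdzm zm1.
rewrite cards1 muln1; set B' := [set a in _ | _]; set I := [set _ | _ in _].
move=> cardA'.
have leB' : (#|B'| <= #|W :&: right_dual (add_line A b)|)%N.
  apply/subset_leq_card/subsetP=> u; rewrite [_ \in B']inE => /andP[/setIP[uW /right_dualP uA] bu].
  have {}bu : coord_form b u = 0 by apply/set1P.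
  rewrite inE uW; apply/right_dualP=> v /imsetP[[r a] /setXP[_ aA] ->] /=.
  by rewrite coord_formDl coord_formZl bu mulr0 uA // addr0.
have leI : (#|I| <= #|[set r | [forall m in M, (m * r)%R == 0%R]]|)%N.
  apply/subset_leq_card/subsetP=> _ /imsetP[[u z] /setXP[uA /set1P->] ->] /=.
  rewrite inE addr0; apply/forall_inP=> m; rewrite /M in_set => mbA.
  by rewrite -coord_formZl; case/setIP: uA => _ /right_dualP->.
have M0 : (0 < #|M|)%N.
  apply/card_gt0P; exists 0; rewrite inE scale0r.
  by case: Asub.
have leM := Frobenius_card_annihilator frobR Mmax.
have leIM : (#|I| * #|M| <= #|R|)%N by apply: leq_trans leM; rewrite leq_mul2r leI orbT.
rewrite -(leq_pmul2r M0) cardA' -!mulnA [(#|add_line _ _| * _)%N]mulnC -cardB.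
by rewrite leq_mul // [(#|A| * _)%N]mulnC mulnA leq_mul2r leIM orbT.
Qed.

Lemma card_dual_mono W A D :
  Frobenius_ring R -> zmod_closed W -> submod_closed A -> submod_closed D ->
  A \subset D ->
  (#|W :&: right_dual A| * #|A| <= #|W :&: right_dual D| * #|D|)%N.
Proof.
move=> frobR Wzm Asub Dsub.
have [k] := ubnP #|D :\: A|; elim: k A Asub => // k IH A Asub ltk AD.
have [/eqP|[b0 b0DA]] := set_0Vmem (D :\: A).
  rewrite setD_eq0 => DA; have -> // : A = D.
  by apply/eqP; rewrite eqEsubset AD.
(* Minimality of |A + R b| makes (A + R b) / A simple: any r b outside A generates the same module
   over A, so b is s r b modulo A for some s. *)
have [b bDA bmin] := arg_minnP (fun b => #|add_line A b|) b0DA.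
have [bD bA] := setDP bDA.
have ABD := add_line_sub Dsub AD bD.
apply: leq_trans (card_dual_add_line (b := b) frobR Wzm Asub _) (IH _ _ _ ABD); last first.
- rewrite (leq_trans _ (ltk : (_ <= k)%N)) //; apply: proper_card; apply/properP; split.
    exact/setDS/sub_add_line.
  by exists b => //; rewrite inE mem_add_line.
- exact: add_line_submod.
have [A0 Alin] := Asub.
apply/maximal_left_idealP; split.
- apply/left_idealP; split; first split.
  + by rewrite inE scale0r.
  + move=> r s; rewrite !inE scalerBl; exact: (GRing.submod_closedB Asub).2.
  + by move=> r s; rewrite !inE -scalerA => sA; rewrite -[_ *: _]addr0 Alin.
- by rewrite inE scale1r.
move=> r; rewrite inE => rbA.
have rbB : r *: b \in add_line A b.
  by apply/add_lineP; exists r; rewrite subrr.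
have rbDA : r *: b \in D :\: A by rewrite inE rbA (subsetP ABD).
have : b \in add_line A (r *: b).
  have /eqP-> : add_line A (r *: b) == add_line A b.
    rewrite eqEcard bmin // add_line_sub ?sub_add_line //; exact: add_line_submod.
  exact: mem_add_line.
by case/add_lineP=> s; exists s; rewrite inE scalerBl scale1r -scalerA.
Qed.

Lemma card_dual W D :
  Frobenius_ring R -> submod_closed W -> W :&: right_dual W = [set 0] ->
  submod_closed D -> D \subset W ->
  (#|D| * #|W :&: right_dual D| = #|W|)%N.
Proof.
move=> frobR Wsub Wnondeg Dsub DW; apply/eqP; rewrite eqn_leq.
have Wzm := GRing.submod_closedB Wsub.
have sub0 : submod_closed [set 0 : 'rV[R]_n].
  by split=> [|r u v]; rewrite !inE // => /eqP-> /eqP->; rewrite scaler0 addr0.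
have D0 : [set 0] \subset D by rewrite sub1set; case: Dsub.
(* Together the two bounds read |W| <= |D| |W :&: right_dual D| <= |W|. *)
have := card_dual_mono frobR Wzm Dsub Wsub DW.
have := card_dual_mono frobR Wzm sub0 Dsub D0.
rewrite Wnondeg !cards1 mul1n muln1 mulnC => le1 ->; apply: leq_trans le1.
apply/subset_leq_card/subsetP=> u uW; rewrite inE uW; apply/right_dualP=> v /set1P->.
by apply: big1 => i _; rewrite mxE mul0r.
Qed.

End Duality.

(** * Averaging and supports on orbits *)

Section OrbitSupport.
Variables (R : finUnitRingType) (n : nat) (H : {group 'S_n}).
Hypothesis H_unit : (#|H|%:R : R) \is a GRing.unit.
Implicit Types (u v : 'rV[R]_n) (C D : {set 'rV[R]_n}).
Implicit Types (O : {set 'I_n}) (S : {set {set 'I_n}}).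

Let W : {set 'rV[R]_n} := theta_set H [set: 'rV[R]_n].
Let o i : {set 'I_n} := orbit 'P H i.

Lemma coord_act_linear h r u v :
  coord_act (r *: u + v) h = r *: coord_act u h + coord_act v h.
Proof. by apply/rowP=> i; rewrite !mxE. Qed.

(** Centrality of 1 / |H| makes [theta] left linear and lets this scalar cross the form, although R
    may be noncommutative. *)
Lemma comm_card_inv (r : R) : GRing.comm r (#|H|%:R)^-1.
Proof. exact/commrV/commr_nat. Qed.

Lemma theta_linear r u v : theta H (r *: u + v) = r *: theta H u + theta H v.
Proof.
rewrite /theta scalerA comm_card_inv -scalerA -scalerDr; congr (_ *: _).
by rewrite scaler_sumr -big_split; apply: eq_bigr => h _; rewrite coord_act_linear.
Qed.

Lemma theta_id v : (forall h, h \in H -> coord_act v h = v) -> theta H v = v.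
Proof.
move=> vH; rewrite /theta (eq_bigr (fun=> v)) // sumr_const -scaler_nat scalerA.
by rewrite mulVr // scale1r.
Qed.

Lemma theta_fixed u : u \in W -> theta H u = u.
Proof. by case/imsetP=> v _ ->; apply: theta_id => h; apply: coord_act_theta. Qed.

Lemma mem_theta_set u :
  (forall i j, i \in o j -> u 0 i = u 0 j) -> u \in W.
Proof.
move=> uo; apply/imsetP; exists u; rewrite // theta_id // => h hH.
apply/rowP=> i; rewrite mxE; apply: uo; apply/orbitP; exists (h^-1)%g => //.
by rewrite groupV.
Qed.

Lemma coord_form_act u v h :
  coord_form (coord_act v h) u = coord_form v (coord_act u h^-1).
Proof.
rewrite /coord_form (reindex_inj (@perm_inj _ h)) /=; apply: eq_bigr => i _.
by rewrite !mxE permK invgK.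
Qed.

Lemma coord_form_sumr (I : finType) (P : pred I) v (F : I -> 'rV[R]_n) :
  coord_form v (\sum_(i | P i) F i) = \sum_(i | P i) coord_form v (F i).
Proof.
rewrite exchange_big /=; apply: eq_bigr => i _.
by rewrite summxE mulr_sumr.
Qed.

Lemma coord_form_suml (I : finType) (P : pred I) v (F : I -> 'rV[R]_n) :
  coord_form (\sum_(i | P i) F i) v = \sum_(i | P i) coord_form (F i) v.
Proof.
rewrite exchange_big /=; apply: eq_bigr => i _.
by rewrite summxE mulr_suml.
Qed.

(** The adjoint of h is its inverse, and inversion permutes H. *)
Lemma coord_form_theta u v : coord_form (theta H v) u = coord_form v (theta H u).
Proof.
have -> : coord_form v (theta H u) =
          (#|H|%:R)^-1 * coord_form v (\sum_(h in H) coord_act u h).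
  rewrite mulr_sumr; apply: eq_bigr => i _.
  by rewrite [in LHS]mxE !mulrA comm_card_inv.
rewrite coord_formZl coord_form_suml coord_form_sumr; congr (_ * _).
rewrite (reindex_inj invg_inj) /=; apply: eq_big => h; first exact: groupV.
by move=> _; rewrite coord_form_act invgK.
Qed.

Lemma theta_set_submod C : submod_closed C -> submod_closed (theta_set H C).
Proof.
case=> C0 Clin; split.
  apply/imsetP; exists 0 => //.
  by have := theta_linear (-1) 0 0; rewrite scaler0 addr0 scaleN1r addNr.
move=> r _ _ /imsetP[u uC ->] /imsetP[v vC ->].
by apply/imsetP; exists (r *: u + v); rewrite ?Clin ?theta_linear.
Qed.

(** For w in C and v in the dual, (w theta, v theta) = (w theta, v) = 0 since w theta is in C.
    Conversely, u in W orthogonal to C theta satisfies (w, u) = (w theta, u) = 0, so u itself is in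
    the dual of C. *)
Lemma theta_set_right_dual C :
  theta_set H C \subset C ->
  theta_set H (right_dual C) = W :&: right_dual (theta_set H C).
Proof.
move=> HC; apply/setP=> u; apply/imsetP/setIP => [[v /right_dualP vC ->]|[uW /right_dualP uC]].
  split; first exact: imset_f.
  apply/right_dualP=> _ /imsetP[w wC ->].
  have twC : theta H w \in theta_set H C by apply: imset_f.
  rewrite -coord_form_theta theta_fixed ?vC ?(subsetP HC) //.
  exact: (subsetP (imsetS _ (subsetT C))).
exists u; rewrite ?theta_fixed //; apply/right_dualP=> w wC.
by rewrite -[u]theta_fixed // -coord_form_theta uC ?imset_f.
Qed.

Lemma theta_set_setT_nondegenerate : W :&: right_dual W = [set 0].
Proof.
apply/setP=> u; rewrite in_set1; apply/setIP/eqP => [[uW /right_dualP uWd]|->]; last first.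
  split; first by apply: mem_theta_set => i j _; rewrite !mxE.
  by apply/right_dualP=> v _; apply: big1 => i _; rewrite mxE mulr0.
apply/rowP=> i; rewrite mxE.
(* For u fixed by [theta], the averaged basis vector still reads off the entry of u at i. *)
have : coord_form (theta H (delta_mx 0 i)) u = 0 by apply/uWd/imset_f.
rewrite coord_form_theta theta_fixed // /coord_form (bigD1 i) //= big1 => [|j ji].
  by rewrite mxE !eqxx mul1r addr0.
by rewrite mxE (negbTE ji) andbF mul0r.
Qed.

Definition orbit_supp u : {set {set 'I_n}} :=
  [set O in coord_orbits H | orbit_coef O u != 0].

Lemma orbit_coefE u i : u \in W -> orbit_coef (o i) u = u 0 i.
Proof.
case/imsetP=> v _ ->; rewrite /orbit_coef; case: pickP => [j ij|/(_ i)].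
  exact: theta_orbit.
by rewrite orbit_refl.
Qed.

Definition supported S : {set 'rV[R]_n} := [set u in W | orbit_supp u \subset S].

Lemma supportedP S u :
  reflect (u \in W /\ forall i, o i \notin S -> u 0 i = 0) (u \in supported S).
Proof.
rewrite inE; apply: (iffP andP) => -[uW uS]; split=> //.
  move=> i; apply: contraNeq => ui; apply: (subsetP uS).
  by rewrite inE orbit_coefE // ui andbT; apply: imset_f.
apply/subsetP=> _ /setIdP[/imsetP[i _ ->]]; apply: contraR => /uS.
by rewrite orbit_coefE // => ->.
Qed.

Lemma supported_submod S : submod_closed (supported S).
Proof.
have Tsub : submod_closed [set: 'rV[R]_n] by split=> [|r u v _ _]; rewrite inE.
have [W0 Wlin] := theta_set_submod Tsub.
split; first by apply/supportedP; split=> // i _; rewrite mxE.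
move=> r u v /supportedP[uW uS] /supportedP[vW vS].
apply/supportedP; split=> [|i iS]; first exact: Wlin.
by rewrite !mxE uS // vS // mulr0 addr0.
Qed.

(** By orbit-stabilizer, |H| is a product of two commuting integers, so each factor is a unit. *)
Lemma card_orbit_unit i : (#|o i|%:R : R) \is a GRing.unit.
Proof.
have := H_unit; rewrite -(card_orbit_stab 'P H i) natrM.
by rewrite unitrM_comm => [/andP[] | ]; last exact: commr_nat.
Qed.

Lemma dual_supported S : S \subset coord_orbits H ->
  W :&: right_dual (supported (coord_orbits H :\: S)) = supported S.
Proof.
move=> SO; apply/setP=> u; apply/setIP/supportedP => -[uW uS]; split=> //; last first.
  apply/right_dualP=> v /supportedP[vW vS]; apply: big1 => i _.
  have [iS|iS] := boolP (o i \in S); last by rewrite uS // mulr0.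
  by rewrite vS ?mul0r // inE iS.
(* Pairing u with the indicator of an orbit outside S gives the orbit length, a unit, times the
   entry of u there. *)
move=> i iS; have /right_dualP/(_ (orbit_vec R (o i))) := uS.
have eqo j k : j \in o k -> o j = o k.
  exact/orbit_eqP.
have -> : coord_form (orbit_vec R (o i)) u = #|o i|%:R * u 0 i.
  rewrite /coord_form (bigID (mem (o i))) /= [X in _ + X]big1 ?addr0 => [|j ji].
    rewrite (eq_bigr (fun=> u 0 i)) ?sumr_const ?mulr_natl // => j ji.
    by rewrite mxE ji mul1r -orbit_coefE // (eqo _ _ ji) orbit_coefE.
  by rewrite mxE (negbTE ji) mul0r.
move=> H0; apply: (mulrI (card_orbit_unit i)); rewrite mulr0 H0 //.
apply/supportedP; split=> [|j]; last first.
  rewrite mxE => jS; case: (boolP (j \in o i)) => // ji.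
  by case/negP: jS; rewrite (eqo _ _ ji) inE iS imset_f.
apply: mem_theta_set => j k jk; rewrite !mxE; congr (_ %:R); congr nat_of_bool.
by rewrite orbit_sym -/(o _) (eqo _ _ jk) orbit_sym.
Qed.

Lemma card_supported S : S \subset coord_orbits H ->
  #|supported S| = (#|R| ^ #|S|)%N.
Proof.
move=> SO.
rewrite -[RHS](card_pffun_on (0 : R) (mem S) (mem R)).
pose F (c : {ffun {set 'I_n} -> R}) : 'rV[R]_n := \row_i c (o i).
rewrite -(card_in_imset (f := F)) /=.
  apply: eq_card => u; apply/supportedP/imsetP => [[uW uS]|[c /pffun_onP[cS _] ->]].
    exists [ffun O => if O \in S then orbit_coef O u else 0].
      apply/pffun_onP; split=> //; apply/subsetP=> O; rewrite inE ffunE.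
      by case: ifP => //; rewrite eqxx.
    apply/rowP=> i; rewrite mxE ffunE; case: ifP => iS; first by rewrite orbit_coefE.
    by rewrite uS ?iS.
  split=> [|i iS].
    apply: mem_theta_set => i j ij; rewrite !mxE; congr (c _).
    exact/orbit_eqP.
  by rewrite mxE; apply: contraNeq iS => ci; apply: (subsetP cS).
move=> c d /pffun_onP[cS _] /pffun_onP[dS _] /rowP eq.
apply/ffunP=> O; have [OS|OS] := boolP (O \in S).
  by have /imsetP[i _ ->] := subsetP SO O OS; have := eq i; rewrite !mxE.
have z (e : {ffun {set 'I_n} -> R}) : support e \subset mem S -> e O = 0.
  by move=> eS; apply: contraNeq OS => eO; apply: (subsetP eS).
by rewrite !z.
Qed.

Lemma theta_set_setTE : W = supported (coord_orbits H).
Proof.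
apply/setP=> u; apply/idP/supportedP => [uW|[]//]; split=> // i.
by case/negP; apply: imset_f.
Qed.

(** With E = D + W_S', the dual of E in W is the intersection of the duals of D and W_S', the latter
    being W_S. Compare |E| |E'| = |W| with |D| |W_S'| = |D :&: W_S'| |E|. *)
Lemma card_dual_supported D S :
  Frobenius_ring R -> submod_closed D -> D \subset W ->
  S \subset coord_orbits H ->
  (#|D| * #|W :&: right_dual D :&: supported S| =
   #|R| ^ #|S| * #|D :&: supported (coord_orbits H :\: S)|)%N.
Proof.
move=> frobR Dsub DW SO; set S' := _ :\: S.
have S'O : S' \subset coord_orbits H := subsetDl _ _.
have [Wsub S'sub] := (supported_submod (coord_orbits H), supported_submod S').
have [D0 Dlin] := Dsub; have [S'0 S'lin] := S'sub.
have [_ Wlin] := Wsub; rewrite -theta_set_setTE in Wsub Wlin.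
have S'W : supported S' \subset W by apply/subsetP=> u /supportedP[].
pose E := [set p.1 + p.2 | p in setX D (supported S')].
have Esub : submod_closed E.
  split; first by apply/imsetP; exists (0, 0); rewrite ?addr0 // in_setX D0.
  move=> r _ _ /imsetP[[u u'] /setXP[uD u'S] ->] /imsetP[[v v'] /setXP[vD v'S] ->].
  apply/imsetP; exists (r *: u + v, r *: u' + v'); first by rewrite in_setX Dlin ?S'lin.
  by rewrite /= scalerDr addrACA.
have EW : E \subset W.
  apply/subsetP=> _ /imsetP[[u u'] /setXP[/(subsetP DW) uW /(subsetP S'W) u'W] ->] /=.
  by rewrite -[u]scale1r Wlin.
have DE : D \subset E.
  by apply/subsetP=> u uD; apply/imsetP; exists (u, 0); rewrite ?addr0 // in_setX uD.
have S'E : supported S' \subset E.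
  by apply/subsetP=> u uS; apply/imsetP; exists (0, u); rewrite ?add0r // in_setX D0.
have Edual : W :&: right_dual E = W :&: right_dual D :&: supported S.
  rewrite -(dual_supported SO) setIACA setIid; congr (_ :&: _).
  apply/setP=> u; apply/right_dualP/setIP => [uE|[/right_dualP uD /right_dualP uS] w].
    by split; apply/right_dualP=> v vD; apply: uE; [apply: (subsetP DE) | apply: (subsetP S'E)].
  by case/imsetP=> [[v v'] /setXP[/uD vu /uS v'u] ->]; rewrite coord_formDl vu v'u addr0.
have cardE := card_dual frobR Wsub theta_set_setT_nondegenerate Esub EW.
have idB : {morph (fun x : 'rV[R]_n => x) : x y / x - y} by [].
have := card_preim_add idB (GRing.submod_closedB Dsub) (GRing.submod_closedB S'sub).
have -> : [set u in D | u \in supported S'] = D :&: supported S'.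
  by apply/setP=> u; rewrite !inE.
rewrite -/E card_supported // => cardDS.
have R0 : (0 < #|R| ^ #|S'|)%N by rewrite expn_gt0; apply/orP; left; apply/card_gt0P; exists 0.
have cardS : (#|S| + #|S'| = #|coord_orbits H|)%N.
  by rewrite -(cardsID S (coord_orbits H)) (setIidPr SO).
have cardW : #|W| = (#|R| ^ #|S| * #|R| ^ #|S'|)%N.
  by rewrite theta_set_setTE card_supported // -expnD cardS.
apply/eqP; rewrite -(eqn_pmul2r R0); apply/eqP.
rewrite mulnAC cardDS -Edual -[RHS]mulnAC -cardW -cardE.
by rewrite [RHS]mulnC mulnA.
Qed.

End OrbitSupport.

(** * Weight enumerators *)

Lemma sum_between_sets (K : comNzRingType) (T : finType) (A Om : {set T}) (x y : K) :
  A \subset Om ->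
  \sum_(S : {set T} | (A \subset S) && (S \subset Om)) x ^+ (#|Om| - #|S|) * y ^+ #|S| =
  (x + y) ^+ (#|Om| - #|A|) * y ^+ #|A|.
Proof.
move=> AO.
(* In the expanded product, i contributes F i when in S and G i otherwise; the zero values kill
   every S not between A and Om. *)
pose F i : K := if i \in Om then y else 0.
pose G i : K := if i \in A then 0 else if i \in Om then x else 1.
have FG i : F i + G i = if i \in A then y else if i \in Om then x + y else 1.
  rewrite /F /G; case: (boolP (i \in A)) => [/(subsetP AO)->|_]; first by rewrite addr0.
  by case: (i \in Om); rewrite ?add0r // addrC.
have prodif (B : {set T}) (z : K) : \prod_(i in B) z = z ^+ #|B| by rewrite prodr_const.
have <- : \prod_i (F i + G i) = (x + y) ^+ (#|Om| - #|A|) * y ^+ #|A|.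
  have -> : (#|Om| - #|A| = #|Om :\: A|)%N by rewrite cardsD (setIidPr AO).
  rewrite -!prodif (bigID (mem A)) /= mulrC; congr (_ * _); last first.
    by apply: eq_bigr => i iA; rewrite FG iA.
  rewrite [RHS]big_mkcond [LHS]big_mkcond /=; apply: eq_bigr => i _.
  by rewrite FG inE; case: (i \in A) => //=.
rewrite bigA_distr [RHS](bigID (fun S : {set T} => (A \subset S) && (S \subset Om))) /=.
rewrite [X in _ + X]big1 ?addr0 => [|S].
  apply: eq_bigr => S /andP[AS SO].
  have -> : (#|Om| - #|S| = #|Om :\: S|)%N by rewrite cardsD (setIidPr SO).
  rewrite -!prodif [RHS](bigID (mem S)) /= mulrC; congr (_ * _).
    by apply: eq_bigr => i iS; rewrite iS /F (subsetP SO).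
  rewrite [LHS]big_mkcond [RHS]big_mkcond /=; apply: eq_bigr => i _; rewrite inE.
  have [//|iS] := boolP (i \in S); rewrite /G (negbTE (contra (subsetP AS i) iS)).
  by case: (i \in Om).
rewrite negb_and => /orP[] /subsetPn[i iP iN]; rewrite (bigD1 i) //=.
  by rewrite (negbTE iN) /G iP mul0r.
by rewrite iP /F (negbTE iN) mul0r.
Qed.

(** Exchanging sums, u is counted for the S between its set of nonzero orbits and all orbits;
    [sum_between_sets] evaluates that inner sum. *)
Lemma sum_card_supported (K : comNzRingType) (R : finUnitRingType) (n : nat)
    (H : {group 'S_n}) (D : {set 'rV[R]_n}) (x y : K) :
  D \subset theta_set H [set: 'rV[R]_n] ->
  \sum_(S : {set {set 'I_n}} | S \subset coord_orbits H)
     (x ^+ (#|coord_orbits H| - #|S|) * y ^+ #|S|) *+ #|D :&: supported R H S| =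
  \sum_(u in D) (x + y) ^+ (#|coord_orbits H| - wtH H u) * y ^+ wtH H u.
Proof.
move=> DW; under eq_bigr do rewrite -sumr_const.
rewrite (exchange_big_dep (mem D)) /= => [|S u _ /setIP[]//].
apply: eq_bigr => u uD; rewrite -sum_between_sets; last by apply/subsetP=> O /setIdP[].
apply: eq_bigl => S.
by rewrite in_setI uD inE (subsetP DW) //= andbC.
Qed.

Theorem theorem3p2 (R : finUnitRingType) (n : nat) (G H : {group 'S_n})
    (C : {set 'rV[R]_n}) :
  Frobenius_ring R ->
  H \subset G ->
  (#|H|%:R : R) \is a GRing.unit ->
  left_G_code G C ->
  weight_enum H (theta_set H (right_dual C)) =
    (#|theta_set H C|%:R : rat)^-1 *:
      (weight_enum H (theta_set H C) \mPo
        [tuple 'X_(0 : 'I_2) + (#|R|%:R - 1) * 'X_(1 : 'I_2);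
               'X_(0 : 'I_2) - 'X_(1 : 'I_2)]).
Proof.
move=> frobR HG H_unit [Csub Cact].
have [C0 Clin] := Csub.
have HC : theta_set H C \subset C.
  apply/subsetP=> _ /imsetP[v vC ->].
  rewrite -[theta H v]addr0; apply: (Clin) => //.
  apply: (big_ind (fun u => u \in C)) => // [u w uC wC|h hH]; first by rewrite -[u]scale1r Clin.
  by apply: Cact => //; apply: (subsetP HG).
rewrite theta_set_right_dual //.
have Dsub := theta_set_submod H Csub.
have DW : theta_set H C \subset theta_set H [set: 'rV[R]_n] by apply/imsetS/subsetT.
move: (theta_set H C) Dsub DW => D Dsub DW.
set W := theta_set H _ in DW *; set Om := coord_orbits H.
set X := 'X_(0 : 'I_2); set Y := 'X_(1 : 'I_2).
(* The sum over supports is taken at (X - Y, Y), since (X - Y) + Y = X. *)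
have -> : weight_enum H (W :&: right_dual D) =
    \sum_(S : {set {set 'I_n}} | S \subset Om)
      ((X - Y) ^+ (#|Om| - #|S|) * Y ^+ #|S|) *+ #|W :&: right_dual D :&: supported R H S|.
  by rewrite sum_card_supported ?subsetIl // subrK.
(* Here it is taken at (|R| Y, X - Y), whose sum is X + (|R| - 1) Y. *)
have -> : weight_enum H D \mPo [tuple X + (#|R|%:R - 1) * Y; X - Y] =
    \sum_(S : {set {set 'I_n}} | S \subset Om)
      ((#|R|%:R * Y) ^+ (#|Om| - #|S|) * (X - Y) ^+ #|S|) *+ #|D :&: supported R H S|.
  rewrite sum_card_supported // raddf_sum; apply: eq_bigr => u _.
  rewrite /= rmorphM !rmorphXn /= !comp_mpolyXU /=; congr (_ ^+ _ * _).
  by rewrite mulrBl mul1r addrCA.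
have D0 : (#|D|%:R : rat) != 0.
  by rewrite Num.Theory.pnatr_eq0 -lt0n; apply/card_gt0P; exists 0; case: Dsub.
rewrite -[LHS](scalerK D0); congr (_ *: _).
(* Complementing S gives Y the exponent |S| on both sides; the factor |R| ^ |S| is then the one in
   [card_dual_supported]. *)
rewrite [RHS](reindex_onto (setD Om) (setD Om)) /=; last first.
  by move=> S SO; rewrite setDDr setDv set0U (setIidPr SO).
rewrite scaler_sumr; apply: eq_big => S.
  rewrite subsetDl setDDr setDv set0U /=.
  by apply/idP/eqP => [/setIidPr|/setIidPr].
move=> SO; have cardS : #|Om :\: S| = (#|Om| - #|S|)%N by rewrite cardsD (setIidPr SO).
rewrite cardS subKn ?subset_leq_card // scaler_nat -mulrnA mulnC.
rewrite card_dual_supported // mulrnA; congr (_ *+ _).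
by rewrite exprMn -natrX -mulrA mulr_natl mulrC.
Qed.
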